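(* There are no wandering gaps of exponential combinatorial type (for the one-sided shift $\sigma$ on $\mathbb{Z}^{\mathbb{N}_0}$).
   Context: $\mathbb{Z}^{\mathbb{N}_0}$ is the space of integer sequences $\underline{s}=s_0s_1s_2\dots$ and $\sigma$ is the shift map $\sigma(s_0s_1s_2\dots)=s_1s_2\dots$. An intermediate external address of length $n\ge1$ is a finite sequence $s_0s_1\dots s_{n-2}\infty$ with $s_j\in\mathbb{Z}$ for $j<n-2$ and $s_{n-2}\in\mathbb{Z}+\frac12$ (for $n=1$ this is just $\infty$). $\overline{\mathbb{S}}$ is the union of $\mathbb{Z}^{\mathbb{N}_0}$ and the set of all intermediate external addresses, and $\mathbb{S}=\overline{\mathbb{S}}\setminus\{\infty\}$. $\mathbb{S}$ carries the lexicographic order, and $\overline{\mathbb{S}}$ carries the cyclic order obtained by adding the point $\infty$ to this linear order; $\overline{\mathbb{S}}$ is order-complete and isomorphic to the circle. Two sets $A,B\subset\overline{\mathbb{S}}$ are unlinked if $A$ is completely contained in one of the (cyclic) intervals of $\overline{\mathbb{S}}\setminus B$, and vice versa. For $A\subset\mathbb{S}$ and $m\in\mathbb{Z}$, the translate $A+m$ is the set obtained by adding $m$ to the initial entry of every address in $A$. A wandering gap is a set $A\subset\mathbb{Z}^{\mathbb{N}_0}$ with $\#\sigma^n(A)\ge3$ for all $n\ge0$ such that $\sigma^{n_1}(A)$ and $\sigma^{n_2}(A)$ are disjoint and unlinked for all non-negative $n_1\ne n_2$. It is of exponential combinatorial type if the sets $\sigma^{n_1}(A)+m_1$ and $\sigma^{n_2}(A)+m_2$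 are disjoint and unlinked whenever $(n_1,m_1)\ne(n_2,m_2)$, where $n_1,n_2\ge0$ and $m_1,m_2\in\mathbb{Z}$. *)

(* Defs.v *)
From mathcomp Require Import all_boot all_order all_algebra.
From mathcomp Require Import boolp classical_sets functions cardinality.

Set Implicit Arguments.
Unset Strict Implicit.
Unset Printing Implicit Defensive.
Import Order.TTheory GRing.Theory Num.Theory.

Local Open Scope classical_set_scope.
Local Open Scope ring_scope.

(** The space of integer sequences [s_0 s_1 s_2 ...] and the one-sided shift. *)
Definition intseq : Type := nat -> int.

Definition shift (s : intseq) : intseq := fun j => s j.+1.

(** The set S.  [Intermediate w k] is the intermediate external address
    [w_0 ... w_(r-1) (k + 1/2) oo] with [r = size w], of length [r + 2]; the
    address [oo] of length 1 is not in S. *)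
Inductive addr : Type :=
  | Infinite of intseq
  | Intermediate of seq int & int.

(** S together with the point [oo], which is [None]. *)
Definition addrbar : Type := option addr.

(** [None] stands for the final entry [oo] of an intermediate address, and for
    the positions past its end. *)
Definition entry (x : addr) (j : nat) : option rat :=
  match x with
  | Infinite s => Some (s j)%:~R
  | Intermediate w k =>
      if (j < size w)%N then Some (nth 0 w j)%:~R
      else if j == size w then Some (k%:~R + 1 / 2)
      else None
  end.

(** Lexicographic order on S.  Two distinct addresses first differ at a
    position where both entries are numbers: an entry in Z + 1/2 common to both
    is followed by [oo] in both.  So [oo] never has to be compared. *)
Definition addr_lt (x y : addr) : Prop :=
  exists n, (forall j, (j < n)%N -> entry x j = entry y j) /\
    match entry x n, entry y n with
    | Some a, Some b => a < b
    | _, _ => False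
    end.

(** Cutting the circle at [oo] and making [oo] the largest element. *)
Definition addrbar_lt (x y : addrbar) : Prop :=
  match x, y with
  | Some a, Some b => addr_lt a b
  | Some _, None => True
  | None, _ => False
  end.

Definition cyclic_lt (x y z : addrbar) : Prop :=
  [\/ addrbar_lt x y /\ addrbar_lt y z,
      addrbar_lt y z /\ addrbar_lt z x |
      addrbar_lt z x /\ addrbar_lt x y].

Definition open_arc (x y : addrbar) : set addrbar :=
  [set z | cyclic_lt x z y].

Definition cyclic_interval (I : set addrbar) : Prop :=
  forall x y, I x -> I y -> open_arc x y `<=` I \/ open_arc y x `<=` I.

(** [I] is one of the intervals of [X], i.e. a maximal nonempty cyclic interval
    contained in [X] (a connected component of [X] as a subset of the circle). *)
Definition interval_of (X I : set addrbar) : Prop :=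
  [/\ I !=set0, I `<=` X, cyclic_interval I &
      forall J, cyclic_interval J -> I `<=` J -> J `<=` X -> J = I].

Definition unlinked (A B : set addrbar) : Prop :=
  (exists I, interval_of (~` B) I /\ A `<=` I) /\
  (exists I, interval_of (~` A) I /\ B `<=` I).

Definition disjoint_unlinked (A B : set addr) : Prop :=
  A `&` B = set0 /\ unlinked (Some @` A) (Some @` B).

Definition translate (m : int) (x : addr) : addr :=
  match x with
  | Infinite s => Infinite (fun j => if j is 0%N then s 0%N + m else s j)
  | Intermediate [::] k => Intermediate [::] (k + m)
  | Intermediate (a :: w) k => Intermediate (a + m :: w) k
  end.

Definition shift_image (n : nat) (A : set intseq) : set intseq :=
  iter n shift @` A.

Definition wandering_gap (A : set intseq) : Prop :=
  (forall n, (`I_3 #<= shift_image n A)%card) /\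
  (forall n1 n2, n1 <> n2 ->
     disjoint_unlinked (Infinite @` shift_image n1 A)
                       (Infinite @` shift_image n2 A)).

Definition exponential_combinatorial_type (A : set intseq) : Prop :=
  forall (n1 n2 : nat) (m1 m2 : int), (n1, m1) <> (n2, m2) ->
    disjoint_unlinked (translate m1 @` (Infinite @` shift_image n1 A))
                      (translate m2 @` (Infinite @` shift_image n2 A)).

(* Main.v *)
Require Import Defs.
From mathcomp Require Import all_boot all_order all_algebra.
From mathcomp Require Import boolp classical_sets functions cardinality.
From mathcomp Require Import zify.

(** Write [A_n] for the [n]-th shift of the gap.  Being unlinked from its own
    translates, [A_n] is shorter than 1, so that its initial entries take at
    most two values, [k] and [k + 1]; say that [n] is a split time if both
    occur.  For two split times [n] and [m], translates of [A_n] and [A_m]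
    straddle the same point of [Z + 1/2], hence are nested, and then one of
    [A_(n+1)] and [A_(m+1)] lies strictly between any two points of the other
    that were separated by the split.  If these two points have a common prefix
    of length [d], so do all points of the set in between.

    Follow three points of the gap.  Each split isolates one of them.  The
    isolated point changes infinitely often, since no two points of the gap have
    the same tail.  At each change, consider the distance between the two
    consecutive split times that isolate different points; by the prefix
    property, these distances strictly decrease from one change to the next. *)

Set Implicit Arguments.
Unset Strict Implicit.
Unset Printing Implicit Defensive.
Import Order.TTheory GRing.Theory Num.Theory.

Local Open Scope classical_set_scope.
Local Open Scope ring_scope.

(** * Lexicographic order on integer sequences *)

Definition lexlt (s t : intseq) : Prop :=
  exists2 n, (forall j, (j < n)%N -> s j = t j) & s n < t n.

Definition transl (m : int) (s : intseq) : intseq :=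
  fun j => if j is 0%N then s 0%N + m else s j.

Lemma iter_shiftE n s j : iter n shift s j = s (n + j)%N.
Proof. by elim: n s j => // n IH s j; rewrite iterSr IH. Qed.

Lemma lexlt_trans s t u : lexlt s t -> lexlt t u -> lexlt s u.
Proof.
move=> [n eqst ltst] [m eqtu lttu].
have [nm|mn|nm] := ltngtP n m.
- exists n; last by rewrite -(eqtu n nm).
  by move=> j jn; rewrite eqst // eqtu //; apply: ltn_trans nm.
- exists m; last by rewrite (eqst m mn).
  by move=> j jm; rewrite eqst ?eqtu //; apply: ltn_trans mn.
- subst m; exists n; last exact: lt_trans lttu.
  by move=> j jn; rewrite eqst // eqtu.
Qed.

Lemma lexlt_total s t : s <> t -> lexlt s t \/ lexlt t s.
Proof.
move=> neq.
have ex : exists n, s n != t n.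
  apply: contrapT => none; apply: neq; apply/funext => n.
  by apply/eqP; apply: contrapT => /negP ne; apply: none; exists n.
case: (ex_minnP ex) => n ne minn.
have eqst j : (j < n)%N -> s j = t j.
  by move=> jn; apply/eqP; apply: contraTT jn => /minn; rewrite -leqNgt.
move: ne; rewrite neq_lt => /orP[lt|lt]; [left|right]; exists n => //.
by move=> j jn; rewrite eqst.
Qed.

Lemma lexlt_head s t : s 0%N < t 0%N -> lexlt s t.
Proof. by exists 0%N. Qed.

Lemma lexlt_head_le s t : lexlt s t -> s 0%N <= t 0%N.
Proof. by move=> [[|n] eqst lt]; [exact: ltW | rewrite eqst]. Qed.

Lemma lexlt_shift s t : lexlt s t -> s 0%N = t 0%N ->
  lexlt (shift s) (shift t).
Proof.
move=> [[|n] eqst lt] eq0; first by rewrite eq0 ltxx in lt.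
by exists n => // j jn; apply: eqst.
Qed.

Lemma lexlt_addr s t : lexlt s t -> addr_lt (Infinite s) (Infinite t).
Proof.
by move=> [n eqst lt]; exists n; split => [j /eqst /= -> //|]; rewrite /= ltr_int.
Qed.

Lemma lexlt_between_prefix s t u d : lexlt s t -> lexlt t u ->
  (forall j, (j < d)%N -> s j = u j) -> forall j, (j < d)%N -> t j = s j.
Proof.
move=> [n1 eq1 lt1] [n2 eq2 lt2] eqd j; elim/ltn_ind: j => j IH jd.
have [jn1|n1j|jn1] := ltngtP j n1; first by rewrite eq1.
  by rewrite (IH n1 n1j (ltn_trans n1j jd)) ltxx in lt1.
subst j; have [jn2|n2j|jn2] := ltngtP n1 n2.
- by rewrite eq2 // eqd.
- have n2d := ltn_trans n2j jd.
  by rewrite (IH n2 n2j n2d) (eqd n2 n2d) ltxx in lt2.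
- by subst n2; have := lt_trans lt1 lt2; rewrite (eqd n1 jd) ltxx.
Qed.

(** * Unlinked sets and nesting around a half-integer *)

Definition crossfree (B C : set intseq) : Prop :=
  forall b b' c c', B b -> B b' -> C c -> C c' ->
    lexlt b c -> lexlt c b' -> lexlt b' c' -> False.

(** If b < c < b' < c', both arcs between [b] and [b'] meet [C]: the one through oo contains [c'].
    The interval around [B] contains one of these arcs but avoids [C]. *)
Lemma unlinked_crossfree (B C : set intseq) :
  unlinked (Some @` (Infinite @` B)) (Some @` (Infinite @` C)) ->
  crossfree B C.
Proof.
move=> [[I [[_ Icomp Iint _] BI]] _] b b' c c' Bb Bb' Cc Cc' bc cb' b'c'.
have inI x : B x -> I (Some (Infinite x)).
  by move=> Bx; apply: BI; exists (Infinite x) => //; exists x.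
have notI x : C x -> ~ I (Some (Infinite x)).
  move=> Cx /Icomp; apply; exists (Infinite x) => //; by exists x.
case: (Iint _ _ (inI b Bb) (inI b' Bb')) => sub.
- by apply: (notI c Cc); apply: sub; constructor 1; split; apply: lexlt_addr.
- apply: (notI c' Cc'); apply: sub; constructor 3.
  by split; apply: lexlt_addr => //; exact: lexlt_trans cb'.
Qed.

(** The last clause says that the set is shorter than 1: [b'] precedes the translate of [b] by 1,
    which has the same initial entry. *)
Definition straddles (B : set intseq) : Prop :=
  [/\ forall b, B b -> b 0%N = 0 \/ b 0%N = 1,
      exists2 b, B b & b 0%N = 0,
      exists2 b, B b & b 0%N = 1 &
      forall b b', B b -> B b' -> b 0%N = 0 -> b' 0%N = 1 ->
        lexlt (shift b') (shift b)].

(** Nesting around the cut between initial entries 0 and 1: on each side, [C] is farther from the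
    cut than [B]. *)
Definition surrounds (C B : set intseq) : Prop :=
  forall b c, B b -> C c ->
    (b 0%N = 0 -> c 0%N = 0 -> lexlt c b) /\
    (b 0%N = 1 -> c 0%N = 1 -> lexlt b c).

Lemma surrounds_total B C : straddles B -> straddles C ->
  (forall b c, B b -> C c -> b <> c) -> crossfree B C -> crossfree C B ->
  surrounds C B \/ surrounds B C.
Proof.
move=> [_ [bl Bbl bl0] [br Bbr br1] _] [_ [cl Ccl cl0] [cr Ccr cr1] _] dis BC CB.
apply: contrapT => /not_orP[nCB nBC].
have lr x y : x 0%N = 0 -> y 0%N = 1 -> lexlt x y.
  by move=> x0 y1; apply: lexlt_head; rewrite x0 y1.
have tot b c : B b -> C c -> lexlt b c \/ lexlt c b.
  by move=> Bb Cc; apply/lexlt_total/dis.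
have [b1 [c1 [Bb1 Cc1 D1]]] : exists b c, [/\ B b, C c &
    [/\ b 0%N = 0, c 0%N = 0 & lexlt b c] \/
    [/\ b 0%N = 1, c 0%N = 1 & lexlt c b]].
  apply: contrapT => none; apply: nCB => b c Bb Cc.
  by split=> b0 c0; case: (tot b c Bb Cc) => // lt; exfalso; apply: none;
    exists b, c; split=> //; first [by left | by right].
have [b2 [c2 [Bb2 Cc2 D2]]] : exists b c, [/\ B b, C c &
    [/\ b 0%N = 0, c 0%N = 0 & lexlt c b] \/
    [/\ b 0%N = 1, c 0%N = 1 & lexlt b c]].
  apply: contrapT => none; apply: nBC => c b Cc Bb.
  by split=> c0 b0; case: (tot b c Bb Cc) => // lt; exfalso; apply: none;
    exists b, c; split=> //; first [by left | by right].
(* Pairs on opposite sides of the cut alternate at once; on the same side, three of the four points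
   alternate with one across the cut. *)
case: D1 => -[b10 c10 lt1]; case: D2 => -[b20 c20 lt2].
- case: (tot b1 c2 Bb1 Cc2) => lt.
  + by apply: (BC b1 b2 c2 cr) => //; apply: lr.
  + by apply: (CB c2 c1 b1 br) => //; apply: lr.
- by apply: (BC b1 b2 c1 c2) => //; apply: lr.
- by apply: (CB c2 c1 b2 b1) => //; apply: lr.
- case: (tot b1 c2 Bb1 Cc2) => lt.
  + by apply: (BC bl b1 c1 c2) => //; apply: lr.
  + by apply: (CB cl c2 b2 b1) => //; apply: lr.
Qed.

(** The shift turns the nesting inside out. The side of the cut on which [c] lies gives one
    inequality; the length bound on [C] gives the other. *)
Lemma surrounds_between B C : straddles C -> surrounds C B ->
  forall x z c, B x -> B z -> C c -> x 0%N = 0 -> z 0%N = 1 ->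
  lexlt (shift z) (shift c) /\ lexlt (shift c) (shift x).
Proof.
move=> [C01 [cl Ccl cl0] [cr Ccr cr1] span] out x z c Bx Bz Cc x0 z1.
have ltx y : C y -> y 0%N = 0 -> lexlt (shift y) (shift x).
  by move=> Cy y0; apply: lexlt_shift; [apply: (out x y Bx Cy).1 | rewrite y0].
have ltz y : C y -> y 0%N = 1 -> lexlt (shift z) (shift y).
  by move=> Cy y1; apply: lexlt_shift; [apply: (out z y Bz Cy).2 | rewrite y1].
have [c0|c1] := C01 c Cc.
- split; last exact: ltx.
  by apply: lexlt_trans (ltz cr Ccr cr1) _; apply: span.
- split; first exact: ltz.
  by apply: lexlt_trans _ (ltx cl Ccl cl0); apply: span.
Qed.

Lemma surrounds_prefix B C : straddles B -> straddles C -> surrounds C B ->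
  forall x z d, B x -> B z -> x 0%N <> z 0%N ->
  (forall j, (0 < j <= d)%N -> x j = z j) ->
  forall c c', C c -> C c' -> forall j, (0 < j <= d)%N -> c j = c' j.
Proof.
move=> [B01 _ _ _] sC out x z d Bx Bz.
wlog [x0 z1] : x z Bx Bz / x 0%N = 0 /\ z 0%N = 1.
  move=> wl neq eqd.
  have [x0|x1] := B01 x Bx; have [z0|z1] := B01 z Bz; try by case: neq; congruence.
  - exact: (wl x z).
  - apply: (wl z x) => //; first exact: nesym.
    by move=> j jd; rewrite eqd.
move=> _ eqd.
suff eqz c : C c -> forall j, (0 < j <= d)%N -> c j = z j.
  by move=> c c' Cc Cc' j jd; rewrite !eqz.
move=> Cc [//|j] jd.
have [lt1 lt2] := surrounds_between sC out Bx Bz Cc x0 z1.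
apply: (lexlt_between_prefix (d := d) lt1 lt2) => // i id.
by rewrite /shift eqd.
Qed.

(** * Translates of the shifts of the gap *)

Section ExponentialGap.

Variable A : set intseq.
Hypothesis expA : exponential_combinatorial_type A.

Let orbit n k : set intseq := [set transl k (iter n shift s) | s in A].

Lemma orbit_image n k :
  translate k @` (Infinite @` shift_image n A) = Infinite @` orbit n k.
Proof. by rewrite /shift_image /orbit !image_comp. Qed.

Lemma orbit_disjoint n m k l : (n, k) <> (m, l) ->
  forall b c, orbit n k b -> orbit m l c -> b <> c.
Proof.
move=> /expA [dis _] b c ob oc eqbc; move: dis; rewrite !orbit_image.
move=> /disjoints_subset /(_ (Infinite b)); apply; first by exists b.
by exists c; rewrite ?eqbc.
Qed.

Lemma orbit_crossfree n m k l : (n, k) <> (m, l) ->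
  crossfree (orbit n k) (orbit m l).
Proof.
by move=> /expA [_]; rewrite !orbit_image; exact: unlinked_crossfree.
Qed.

Lemma orbit_short n s t : A s -> A t ->
  lexlt (transl 0 (iter n shift s)) (transl 1 (iter n shift t)).
Proof.
move=> As At.
have ne : (n, 0) <> (n, 1) :> nat * int by [].
have o k r : A r -> orbit n k (transl k (iter n shift r)) by move=> Ar; exists r.
have lt01 r : lexlt (transl 0 (iter n shift r)) (transl 1 (iter n shift r)).
  by apply: lexlt_head; rewrite /= ltrD2l.
case: (lexlt_total (orbit_disjoint ne (o _ _ As) (o _ _ At))) => // lt.
(* Otherwise t < t + 1 < s < s + 1, read after [n] shifts, would alternate between the two
   orbits. *)
case: (orbit_crossfree ne (o _ _ At) (o _ _ As) (o _ _ At) (o _ _ As)) => //.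
Qed.

Lemma entry_le n s t : A s -> A t -> s n <= t n + 1.
Proof.
move=> As At; have := lexlt_head_le (orbit_short n As At).
by rewrite /= !iter_shiftE addn0 addr0.
Qed.

Lemma entry_succ n s t : A s -> A t -> s n = t n + 1 ->
  lexlt (iter n.+1 shift s) (iter n.+1 shift t).
Proof.
move=> As At eqst; apply: (lexlt_shift (orbit_short n As At)).
by rewrite /= !iter_shiftE addn0 addr0.
Qed.

Lemma tails_differ s t n : A s -> A t -> s <> t ->
  exists2 m, (n <= m)%N & s m <> t m.
Proof.
move=> As At; elim: n => [|n IH] neq.
  apply: contrapT => none; apply: neq; apply/funext => j.
  by apply: contrapT => ne; apply: none; exists j.
have [m nm neqm] := IH neq.
apply: contrapT => none.
have eqst j : (n < j)%N -> s j = t j.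
  by move=> nj; apply: contrapT => ne; apply: none; exists j.
have neqn : s n <> t n.
  move: nm; rewrite leq_eqVlt => /orP[/eqP->|/eqst] //.
(* With equal tails after [n], the [n]-th shifts of [s] and [t] differ by this integer translation,
   so a nontrivial translate of the shifted gap would meet it. *)
have ne : (n, 0) <> (n, s n - t n).
  by move=> [] /esym /eqP; rewrite subr_eq0 => /eqP.
apply: (orbit_disjoint ne (b := transl 0 (iter n shift s))
                          (c := transl (s n - t n) (iter n shift t))).
- by exists s.
- by exists t.
- apply/funext => -[|j] /=; rewrite !iter_shiftE.
  + by rewrite addn0 addr0 addrC subrK.
  + by apply: eqst; rewrite addnS ltnS leq_addr.
Qed.

Lemma split_straddles n p q : A p -> A q -> p n < q n ->
  straddles (orbit n (- p n)).
Proof.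
move=> Ap Aq ltpq.
have head r : transl (- p n) (iter n shift r) 0%N = r n - p n.
  by rewrite /= iter_shiftE addn0.
have qn : q n - p n = 1 by have := entry_le n Aq Ap; lia.
split.
- move=> _ [r Ar <-]; rewrite head.
  have := entry_le n Ar Ap; have := entry_le n Aq Ar; lia.
- by exists (transl (- p n) (iter n shift p)); [exists p | rewrite head subrr].
- by exists (transl (- p n) (iter n shift q)); [exists q | rewrite head].
- move=> _ _ [r Ar <-] [r' Ar' <-]; rewrite !head => r0 r1.
  by apply: (entry_succ (n := n) Ar' Ar); lia.
Qed.

(** * Split times and their comparison *)

Let split n := exists s t, [/\ A s, A t & s n <> t n].

Lemma split_base n : split n -> exists k, straddles (orbit n k).
Proof.
move=> [s [t [As At /eqP]]]; rewrite neq_lt => /orP[lt|lt].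
- by exists (- s n); apply: split_straddles lt.
- by exists (- t n); apply: split_straddles lt.
Qed.

(** The trace that nesting leaves on entries; it makes any two distinct split times comparable. *)
Definition prefix_le (n m : nat) : Prop :=
  forall s t d, A s -> A t -> s n <> t n ->
  (forall j, (0 < j <= d)%N -> s (n + j)%N = t (n + j)%N) ->
  forall r r', A r -> A r' ->
  forall j, (0 < j <= d)%N -> r (m + j)%N = r' (m + j)%N.

Lemma orbit_surrounds_prefix n m k l :
  straddles (orbit n k) -> straddles (orbit m l) ->
  surrounds (orbit m l) (orbit n k) -> prefix_le n m.
Proof.
move=> sn sm out s t d As At neq eqd r r' Ar Ar' j jd.
have o i h q : A q -> orbit i h (transl h (iter i shift q)) by move=> Aq; exists q.
have trE i h q a : (0 < a)%N -> transl h (iter i shift q) a = q (i + a)%N.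
  by case: a => // a _; rewrite /= -iter_shiftE.
have j0 : (0 < j)%N by case/andP: jd.
rewrite -(trE m l r j j0) -(trE m l r' j j0).
apply: (surrounds_prefix sn sm out (o n k s As) (o n k t At) _ _
  (o m l r Ar) (o m l r' Ar') jd).
- by rewrite /= !iter_shiftE addn0 => /addIr.
- by move=> i /[dup] /andP[i0 _] id; rewrite !trE // eqd.
Qed.

Lemma prefix_le_total n m : n <> m -> split n -> split m ->
  prefix_le n m \/ prefix_le m n.
Proof.
move=> nm /split_base[k sn] /split_base[l sm].
have ne : (n, k) <> (m, l) by case.
have [out|out] := surrounds_total sn sm (orbit_disjoint ne)
  (orbit_crossfree ne) (orbit_crossfree (nesym ne)).
- by left; apply: orbit_surrounds_prefix out.
- by right; apply: orbit_surrounds_prefix out.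
Qed.

(* [m] and [m'] are consecutive split times of [u], [v], [w]; the isolated
   point is [v] at [m] and [w] at [m']. *)
Definition change (m m' : nat) (u v w : intseq) : Prop :=
  [/\ (m < m')%N, u m = w m /\ u m <> v m, u m' = v m' /\ u m' <> w m' &
      forall j, (m < j < m')%N -> u j = v j /\ u j = w j].

(** * Descent along changes of the isolated point *)

Lemma next_change m u v w : A u -> A v -> A w -> u <> v ->
  u m = v m -> u m <> w m ->
  exists m2 m2', [/\ (m <= m2)%N,
    forall j, (m <= j < m2')%N -> u j = v j, u m2' <> v m2' &
    change m2 m2' u w v \/ change m2 m2' v w u].
Proof.
move=> Au Av Aw uv uvm uwm.
have ex : exists M, (m <= M)%N && (u M != v M).
  by have [M mM /eqP neM] := tails_differ m Au Av uv; exists M; rewrite mM.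
(* The first time from [m] on at which [u] and [v] part; before it, only [w] can be isolated. *)
case: (ex_minnP ex) => M /andP[mM /eqP neM] minM {ex}.
have eqM j : (m <= j < M)%N -> u j = v j.
  move=> /andP[mj jM]; apply/eqP; apply: contraTT jM => ne.
  by rewrite -leqNgt minM // mj.
have ltmM : (m < M)%N.
  by rewrite ltn_neqAle mM andbT; apply/eqP => eqm; apply: neM; rewrite -eqm.
have ex : exists n, (m <= n < M)%N && (u n != w n).
  by exists m; rewrite leqnn ltmM; apply/eqP.
have bd n : (m <= n < M)%N && (u n != w n) -> (n <= M)%N.
  by move=> /andP[/andP[_ /ltnW]].
(* The last split before [M]; it isolates [w]. *)
case: (ex_maxnP ex bd) => n /andP[/andP[mn nM] /eqP nen] maxn.
have uvn : u n = v n by apply: eqM; rewrite mn.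
have uwj j : (n < j < M)%N -> u j = w j.
  move=> /andP[nj jM]; apply/eqP/negPn/negP => ne.
  by have := maxn j; rewrite jM ne (leq_trans mn (ltnW nj)) leqNgt nj => /(_ isT).
exists n, M; split=> //.
have uvj j : (n < j < M)%N -> u j = v j.
  by move=> /andP[nj jM]; apply: eqM; rewrite jM (leq_trans mn (ltnW nj)).
have [uwM|uwM] := eqVneq (u M) (w M); [left|right].
  by split=> //; split; [exact: uwj|exact: uvj].
split=> //.
- by split; congruence.
(* Entries at [M] pairwise differ by at most 1, so the three points take at most two values. *)
- suff vwM : v M = w M by split; [|exact: nesym].
  have := entry_le M Au Av; have := entry_le M Av Au.
  have := entry_le M Au Aw; have := entry_le M Aw Au.
  have := entry_le M Aw Av; have := entry_le M Av Aw.
  by move: uwM neM => /eqP; lia.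
- by move=> j nj; have := uwj j nj; have := uvj j nj => <-.
Qed.

Lemma change_descent m m' u v w : A u -> A v -> A w -> change m m' u v w ->
  exists m2 m2' u2 v2 w2,
    [/\ change m2 m2' u2 v2 w2, (m2' - m2 < m' - m)%N, A u2, A v2 & A w2].
Proof.
move=> Au Av Aw [mm' [uwm uvm] [uvm' uwm'] eqmm'].
have uv : u <> v by move=> eqv; apply: uvm; rewrite eqv.
have [n [M [m'n eqM neM ch]]] := next_change Au Av Aw uv uvm' uwm'.
(* The split at [M] isolates [y]; here [x] and [y] are [u] and [v] in one order or the other. *)
suff main x y : A x -> A y -> change n M x w y -> (M - n < m' - m)%N.
  by case: ch => ch; do 5!eexists; split; try exact: ch; rewrite ?(main _ _ _ _ ch).
move=> Ax Ay [nM [xyn xwn] [xwM xyM] eqnM].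
(* The agreement includes [M] itself, where [y] is the isolated point. *)
have eqxw j : (0 < j <= M - n)%N -> x (n + j)%N = w (n + j)%N.
  move=> jM; have [->//|/eqP ne] := eqVneq (n + j)%N M.
  by apply: (eqnM _ _).1; lia.
have equv j : (0 < j <= M - m - 1)%N -> u (m + j)%N = v (m + j)%N.
  move=> jM; have [lt|ge] := ltnP (m + j) m'.
    by apply: (eqmm' _ _).1; lia.
  by apply: eqM; lia.
have nm : m <> n by lia.
have [ps|ps] := prefix_le_total nm (ex_intro _ u (ex_intro _ v (And3 Au Av uvm)))
    (ex_intro _ x (ex_intro _ w (And3 Ax Aw xwn))).
(* Since [m < n], a common prefix of length [M - m - 1] after [n] reaches [M], where [u] and [v]
   differ. *)
- case: neM; have := ps _ _ _ Au Av uvm equv _ _ Au Av (M - n)%N.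
  by rewrite subnKC ?(ltnW nM) //; apply; lia.
(* If [M - n] were at least [m' - m], all points of [A] would agree at [m'], where [w] is
   isolated. *)
- rewrite ltnNge; apply/negP => le.
  case: uwm'; have := ps _ _ _ Ax Aw xwn eqxw _ _ Au Aw (m' - m)%N.
  by rewrite subnKC ?(ltnW mm') //; apply; lia.
Qed.

Lemma no_change m m' u v w : A u -> A v -> A w -> ~ change m m' u v w.
Proof.
have [e] := ubnP (m' - m)%N; elim: e m m' u v w => // e IH m m' u v w lt.
move=> Au Av Aw /(change_descent Au Av Aw).
move=> [m2 [m2' [u2 [v2 [w2 [ch lt2 Au2 Av2 Aw2]]]]]].
by apply: IH ch => //; apply: leq_trans lt2 _.
Qed.

Lemma three_points_equal u v w : A u -> A v -> A w ->
  u <> v -> v <> w -> u <> w -> False.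
Proof.
move=> Au Av Aw uv vw uw.
have no m x y z : A x -> A y -> A z -> x <> y -> x <> z -> y <> z ->
    x m = y m -> x m <> z m -> False.
  move=> Ax Ay Az xy xz yz xym xzm.
  have [n [n' [_ _ _ [ch|ch]]]] := next_change Ax Ay Az xy xym xzm.
  - exact: no_change ch.
  - exact: no_change ch.
have [m _ uvm] := tails_differ 0 Au Av uv.
(* At most two values occur at [m], so one of the three points is isolated there. *)
have [uwm|/eqP uwm] := eqVneq (u m) (w m).
  by apply: (no m u w v) => //; exact: nesym.
apply: (no m v w u) => //; try exact: nesym.
have := entry_le m Au Av; have := entry_le m Av Au.
have := entry_le m Au Aw; have := entry_le m Aw Au.
have := entry_le m Aw Av; have := entry_le m Av Aw.
by lia.
Qed.

End ExponentialGap.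

Theorem theorem6p13 :
  ~ exists A : set intseq,
      wandering_gap A /\ exponential_combinatorial_type A.
Proof.
move=> [A [[card3 _] expA]].
have /card_leP[f] := card3 0%N.
pose pt i (i3 : (i < 3)%N) : intseq := val (f (exist _ i (mem_set i3))).
have inA i i3 : A (@pt i i3).
  by have [s As eqs] := set_valP (f (exist _ i (mem_set i3))); rewrite /pt -eqs.
have neq i j i3 j3 : i <> j -> @pt i i3 <> @pt j j3.
  move=> ij /val_inj eqf; apply: ij.
  by have := inj (in_setT _) (in_setT _) eqf => -[].
by apply: (three_points_equal expA (inA 0%N isT) (inA 1%N isT) (inA 2%N isT));
  apply: neq.
Qed.
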